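(* Let $q\ge 4$ be a prime power, let $n=m(2,q)$ (that is, $n=q+2$ if $q$ is even and $n=q+1$ if $q$ is odd; in particular $n$ is even), and let $\mathcal{C}\leqslant\mathbb{F}_q^n$ be an $[n,3,n-2]_q$ MDS code. Then $\mathcal{C}$ is an $n/2$-PIR code.
   Context: An $[n,k,d]_q$ code is a $k$-dimensional linear subspace of $\mathbb{F}_q^n$ with minimum Hamming distance $d$; it is MDS if $d+k=n+1$. For $\mathbf{G}=(\mathbf{g}_1\mid\dots\mid\mathbf{g}_n)\in\mathbb{F}_q^{k\times n}$ with columns $\mathbf{g}_j$, and $i\in[k]$, a recovery set for the $i$-th object (message symbol) is a set $J\subseteq[n]$ such that $\mathbf{e}_i\in\langle\mathbf{g}_j : j\in J\rangle$, where $\mathbf{e}_i$ is the $i$-th standard basis vector of $\mathbb{F}_q^k$. An $[n,k]_q$ code is a $t$-PIR code if it has a generator matrix $\mathbf{G}\in\mathbb{F}_q^{k\times n}$ such that for every $i\in[k]$ there exist $t$ pairwise disjoint recovery sets for the $i$-th object. *)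

(* Defs.v *)
From HB Require Import structures.
From mathcomp Require Import all_boot all_order all_algebra all_field.
Set Implicit Arguments.
Unset Strict Implicit.
Unset Printing Implicit Defensive.
Import GRing.Theory.
Local Open Scope ring_scope.

(* The maximum size of an arc in the projective plane over a field with
   q elements. *)
Definition m2 (q : nat) : nat := if odd q then q.+1 else q.+2.

Definition hamming_dist (F : finFieldType) (n : nat) (x y : 'rV[F]_n) : nat :=
  #|[set j : 'I_n | x 0 j != y 0 j]|.

Definition has_min_dist (F : finFieldType) (n : nat)
    (C : {vspace 'rV[F]_n}) (d : nat) : Prop :=
  (exists x y, [/\ x \in C, y \in C, x != y & hamming_dist x y = d]) /\
  (forall x y, x \in C -> y \in C -> x != y -> (d <= hamming_dist x y)%N).

Definition is_code (F : finFieldType) (n k d : nat)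
    (C : {vspace 'rV[F]_n}) : Prop :=
  \dim C = k /\ has_min_dist C d.

Definition is_mds_code (F : finFieldType) (n k d : nat)
    (C : {vspace 'rV[F]_n}) : Prop :=
  is_code k d C /\ (d + k = n + 1)%N.

Definition generator_matrix (F : finFieldType) (n k : nat)
    (C : {vspace 'rV[F]_n}) (G : 'M[F]_(k, n)) : Prop :=
  basis_of C [seq row i G | i : 'I_k].

Definition recovery_set (F : finFieldType) (n k : nat)
    (G : 'M[F]_(k, n)) (i : 'I_k) (J : {set 'I_n}) : Prop :=
  (delta_mx i 0 : 'cV[F]_k) \in <<[seq col j G | j in J]>>%VS.

(* The dimension k is forced to be \dim C by the existence of G. *)
Definition is_pir_code (F : finFieldType) (n k t : nat)
    (C : {vspace 'rV[F]_n}) : Prop :=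
  exists G : 'M[F]_(k, n),
    generator_matrix C G /\
    forall i : 'I_k, exists J : 'I_t -> {set 'I_n},
      (forall a, recovery_set G i (J a)) /\
      (forall a b, a != b -> [disjoint J a & J b]).

(* Main.v *)
Require Import Defs.
From mathcomp Require Import all_boot all_order all_algebra all_field.
From mathcomp Require Import zify.

(** The columns g_j of a generator matrix form an arc of size n in PG(2,q). If a
    point P off the arc lies on no tangent, every line joining P to an arc point
    meets the arc in exactly two points, so the arc splits into n/2 pairs whose
    chords pass through P. If three non-collinear points have this property, a
    change of basis turns them into e_1, e_2, e_3, and the pairs are the
    recovery sets.

    Such points exist by counting. Each arc point is on q + 2 - n tangents, and
    since n is even, a point off the arc on one tangent is on at least two. This
    bounds the number of vectors of F_q^3 on tangents, and more than q^2 vectors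
    remain, too many for a plane. *)

Set Implicit Arguments.
Unset Strict Implicit.
Unset Printing Implicit Defensive.
Import GRing.Theory.
Local Open Scope ring_scope.

Lemma sum_indicator (T : finType) (p : pred T) :
  (\sum_x (p x : nat) = #|[set x | p x]|)%N.
Proof. by rewrite -sum1dep_card [RHS]big_mkcond; apply: eq_bigr => x _; case: (p x). Qed.

(** * Parity of partitions into blocks of at most two elements *)

Section SmallBlocks.
Variables (T : finType) (P : {set {set T}}) (D : {set T}).
Hypotheses (partP : partition P D) (P2 : {in P, forall B : {set T}, #|B| <= 2}%N).

(** Blocks of a partition are nonempty, so those that are not singletons have exactly two elements
    and contribute an even number. *)
Lemma odd_card_singleton_blocks :
  odd #|D| = odd #|[set B in P | #|B| == 1%N]|.
Proof.
rewrite (card_partition partP) (bigID (fun B : {set T} => #|B| == 1%N)) /=.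
under eq_bigr => B /andP[_ /eqP->] do [].
have -> : (\sum_(B in P | #|B| != 1%N) #|B| =
           \sum_(B in P | #|B| != 1%N) 2)%N.
  apply: eq_bigr => B /andP[PB nB1].
  have := P2 PB; have := card_gt0 B.
  have -> : B != set0 by apply: contraTneq PB => ->; case/and3P: partP.
  by lia.
rewrite !sum_nat_cond_const oddD muln2 odd_double muln1 addbF.
by congr (odd _); apply: eq_card => B; rewrite !inE.
Qed.

Lemma ex_other_singleton_block (x : T) :
  ~~ odd #|D| -> [set x] \in P -> exists2 y, y != x & [set y] \in P.
Proof.
rewrite odd_card_singleton_blocks => even_s Px.
set S := [set B in P | _] in even_s.
have Sx : [set x] \in S by rewrite inE Px cards1.
have /card_gt0P[B] : (0 < #|S :\ [set x]|)%N.
  by move: even_s; rewrite (cardsD1 [set x] S) Sx; case: #|_|.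
rewrite !inE => /and3P[nBx PB /cards1P[y defB]].
by exists y; [apply: contraNneq nBx => <-; rewrite defB | rewrite -defB].
Qed.

End SmallBlocks.

(** * Arcs in the projective plane: chords and tangents *)

Section Arc.
Variables (F : finFieldType) (I : finType) (g : I -> 'cV[F]_3).

(** No three points are collinear, in homogeneous coordinates. Once [I] has three elements, this
    also makes the [g i] nonzero and pairwise non-proportional. *)
Definition arc : Prop :=
  forall i j k, uniq [:: i; j; k] -> free [:: g i; g j; g k].

Hypotheses (gP : arc) (I3 : (3 <= #|I|)%N).
Local Notation q := #|F|.
Local Notation chord i j := <<[:: g i; g j]>>%VS.

Lemma ex_third (i j : I) : exists k, (k != i) && (k != j).
Proof.
have : (0 < #|~: [set i; j]|)%N.
  by have := cardsC [set i; j]; rewrite cards2; case: (i != j); lia.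
by case/card_gt0P => k; rewrite !inE negb_or => ?; exists k.
Qed.

Lemma dim_chord i j : i != j -> \dim (chord i j) = 2.
Proof.
move=> nij; have [k /andP[nki nkj]] := ex_third i j.
have : free [:: g k; g i; g j] by apply: gP; rewrite /= !inE negb_or nki nkj nij.
by rewrite free_cons => /andP[_ /eqP].
Qed.

Lemma dim_point i : \dim <[g i]>%VS = 1%N.
Proof.
have [j /andP[nji _]] := ex_third i i; have [k /andP[nki nkj]] := ex_third i j.
have : free [:: g k; g j; g i] by apply: gP; rewrite /= !inE negb_or nki nkj nji.
by rewrite !free_cons => /and4P[_ _ gi0 _]; rewrite dim_vline; move: gi0;
   rewrite span_nil memv0 => ->.
Qed.

Lemma point_sub_chordl i j : (<[g i]> <= chord i j)%VS.
Proof. by rewrite -memvE memv_span ?mem_head. Qed.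

Lemma chordC i j : chord i j = chord j i.
Proof. by apply: eq_span => x; rewrite !inE orbC. Qed.

(** The sum of the two planes contains three independent vectors, so the dimension formula leaves at
    most dimension 1 for the intersection. *)
Lemma cap_chord i j k :
  uniq [:: i; j; k] -> (chord i j :&: chord i k)%VS = <[g i]>%VS.
Proof.
move=> ijk; apply/esym/eqP; rewrite eqEdim subv_cap !point_sub_chordl /=.
have /and3P[] := ijk; rewrite !inE negb_or => /andP[nij nik] njk _.
have := dimv_sum_cap (chord i j) (chord i k).
rewrite !dim_chord // dim_point.
have : (3 <= \dim (chord i j + chord i k))%N.
  have /eqP/= dim3 := gP ijk; apply: leq_trans (_ : \dim <<[:: g i; g j; g k]>> <= _)%N.
    by rewrite dim3.
  apply/dimvS/span_subvP => x.
  rewrite !inE => /or3P[] /eqP->.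
  - by rewrite memvE (subv_trans (point_sub_chordl i j)) ?addvSl.
  - by rewrite memvE (subv_trans _ (addvSl _ _)) // chordC point_sub_chordl.
  - by rewrite memvE (subv_trans _ (addvSr _ _)) // chordC point_sub_chordl.
by lia.
Qed.

(* The vectors of chord i j, j != i, form the plane of a line through the point
   g i that meets the arc again; so v is on a tangent at g i when v is outside
   all of these planes. Multiples of g i are excluded. *)
Definition on_tangent (i : I) (v : 'cV[F]_3) : bool :=
  [forall j, (j != i) ==> (v \notin chord i j)].

Lemma card_chordD i j : j != i ->
  (#|[set v | (v \in chord i j) && (v \notin <[g i]>%VS)]| = q ^ 2 - q)%N.
Proof.
move=> nji; have := card_vspace (chord i j); have := card_vspace <[g i]>%VS.
rewrite dim_chord 1?eq_sym // dim_point expn1 => <- <-.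
rewrite -[#|chord i j|](cardID (mem <[g i]>%VS)).
have -> : #|[predI chord i j & mem <[g i]>%VS]| = #|<[g i]>%VS|.
  apply: eq_card => v; rewrite !inE andb_idl // => /(subvP (point_sub_chordl i j)).
  exact.
by rewrite addKn; apply: eq_card => v; rewrite !inE andbC.
Qed.

(* The chords through g i pairwise meet in <[g i]> only. *)
Lemma card_on_tangent i :
  (#|[set v | on_tangent i v]| + #|I|.-1 * (q ^ 2 - q) + q <= q ^ 3)%N.
Proof.
have -> : (q ^ 3 = \sum_(v : 'cV[F]_3) 1)%N by rewrite sum1_card card_mx muln1.
have card_gi : q = #|[set v | v \in <[g i]>%VS]|.
  by rewrite cardsE card_vspace dim_point expn1.
rewrite [X in (_ + X <= _)%N]card_gi.
have -> : (#|I|.-1 * (q ^ 2 - q) = \sum_(j | j != i)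
    #|[set v | (v \in chord i j) && (v \notin <[g i]>%VS)]|)%N.
  under eq_bigr => j nji do rewrite card_chordD //.
  by rewrite sum_nat_const; congr (_ * _)%N; rewrite -(cardC1 i); apply: eq_card.
under eq_bigr => j nji do rewrite -sum_indicator.
(* The comparison is made vector by vector: each [v] is counted at most once, as a multiple of
   [g i], on a single chord, or on a tangent. *)
rewrite exchange_big -!sum_indicator -!big_split /=; apply: leq_sum => v _.
have [gi_v | gi'v] := boolP (v \in <[g i]>%VS).
  rewrite big1 => [|j _]; last by rewrite andbF.
  have [j /andP[nji _]] := ex_third i i.
  have /negPf -> // : ~~ on_tangent i v.
  apply/forallP => /(_ j); rewrite nji /= => /negP[].
  exact: subvP (point_sub_chordl i j) _ gi_v.
have [tv | ntv] := boolP (on_tangent i v).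
  rewrite big1 // => j nji; have /forallP/(_ j) := tv.
  by rewrite nji /= => /negPf ->.
have [j /andP[nji ijv]] : exists j, (j != i) && (v \in chord i j).
  move: ntv; rewrite negb_forall => /existsP[j].
  by rewrite negb_imply negbK; exists j.
rewrite (bigD1 j) //= ijv big1 // => k /andP[nki nkj]; apply/eqP.
rewrite eqb0 andbT; apply: contra gi'v => ikv.
rewrite -(@cap_chord i j k) ?memv_cap ?ijv //.
by rewrite /= !inE negb_or (eq_sym i j) (eq_sym i k) (eq_sym j k) nji nki nkj.
Qed.

(** Multiples of an arc point are excluded separately: they lie in a chord plane at every arc point,
    so [on_tangent] never holds for them. *)
Definition on_no_tangent (v : 'cV[F]_3) : bool :=
  [forall i, (v \notin <[g i]>%VS) && ~~ on_tangent i v].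

(** * The pairing of the arc induced by a point off it *)

Section Pairing.
Variable v : 'cV[F]_3.
Hypothesis v_off : forall i, v \notin <[g i]>%VS.

(** The case [i == j] is needed for reflexivity: [chord i i] is just the span of [g i], which misses
    [v]. *)
Definition paired (i j : I) : bool := (i == j) || (v \in chord i j).

Lemma paired_uniq i j k : uniq [:: i; j; k] -> paired i j -> ~~ paired i k.
Proof.
move=> ijk; rewrite /paired; have /and3P[] := ijk.
rewrite !inE negb_or => /andP[/negPf-> /negPf->] _ _ /= ijv.
by apply: contra (v_off i) => ikv; rewrite -(cap_chord ijk) memv_cap ijv.
Qed.

Lemma pairedC : symmetric paired.
Proof. by move=> i j; rewrite /paired eq_sym chordC. Qed.

(** For distinct indices the hypotheses are contradictory, since [paired_uniq] allows [j] only one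
    partner. *)
Lemma paired_trans : transitive paired.
Proof.
move=> j i k ij jk; have [-> | nik] := eqVneq i k; first by rewrite /paired eqxx.
have [<- // | nji] := eqVneq j i; have [-> // | nkj] := eqVneq k j.
suff /negP[] : ~~ paired j k by [].
apply: (@paired_uniq j i k); last by rewrite pairedC.
by rewrite /= !inE negb_or nji nik eq_sym nkj.
Qed.

Lemma paired_equiv : {in [set: I] & &, equivalence_rel paired}.
Proof.
move=> i j k _ _ _; split; first by rewrite /paired eqxx.
move=> ij; apply/idP/idP; last exact: paired_trans.
by apply: paired_trans; rewrite pairedC.
Qed.

Definition pairing := equivalence_partition paired [set: I].

Lemma pairing_partition : partition pairing [set: I].
Proof. exact/equivalence_partitionP/paired_equiv. Qed.

Lemma pairing_block B :
  B \in pairing -> exists i, B = [set j | paired i j].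
Proof.
case/imsetP => i _ ->; exists i; by apply/setP => j; rewrite !inE.
Qed.

Lemma mem_pairing i : [set j | paired i j] \in pairing.
Proof. by apply/imsetP; exists i => //; apply/setP => j; rewrite !inE. Qed.

(** This turns tangents through [v] into singleton blocks, to which the parity argument applies. *)
Lemma on_tangent_block i : on_tangent i v = ([set i] \in pairing).
Proof.
apply/idP/idP => [tv | /pairing_block[k defk]].
  rewrite -(_ : [set j | paired i j] = [set i]) ?mem_pairing //.
  apply/setP => j; rewrite !inE /paired eq_sym; have [//|nji] := eqVneq j i.
  by have /forallP/(_ j) := tv; rewrite nji /= => /negPf.
have ki : paired k i by have := set11 i; rewrite defk inE.
apply/forallP => j; apply/implyP => nji; apply: contra nji => ijv.
by rewrite -in_set1 defk inE (paired_trans ki) // /paired ijv orbT.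
Qed.

Lemma pairing_le2 : {in pairing, forall B : {set I}, #|B| <= 2}%N.
Proof.
move=> B /pairing_block[i ->]; rewrite leqNgt.
apply/card_gt2P => -[x [y [z [[]]]]]; rewrite !inE => ix iy iz [nxy nyz nzx].
have xy : paired x y by apply: paired_trans iy; rewrite pairedC.
suff /negP[] : ~~ paired x z by apply: paired_trans iz; rewrite pairedC.
by apply: paired_uniq xy; rewrite /= !inE negb_or nxy nyz eq_sym nzx.
Qed.

Lemma ex_other_tangent i :
  ~~ odd #|I| -> on_tangent i v -> exists2 j, j != i & on_tangent j v.
Proof.
rewrite on_tangent_block => evenI iv; rewrite -cardsT in evenI.
have [j nji jv] := ex_other_singleton_block pairing_partition pairing_le2 evenI iv.
by exists j; rewrite ?on_tangent_block.
Qed.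

End Pairing.

(** * Points on no tangent: their chords and their number *)

Lemma on_no_tangent_disjoint_chords v : on_no_tangent v ->
  exists J : 'I_(#|I|./2) -> {set I},
    (forall a, exists i j, J a = [set i; j] /\ v \in chord i j) /\
    (forall a b, a != b -> [disjoint J a & J b]).
Proof.
move=> /forallP v_good.
have v_off i : v \notin <[g i]>%VS by case/andP: (v_good i).
have partP := pairing_partition v_off.
(* Without tangents there are no singleton blocks, so every block is a pair whose chord contains
   [v]. *)
have P2 : {in pairing v, forall B : {set I}, exists i j,
    [/\ i != j, B = [set i; j] & v \in chord i j]}.
  move=> B PB; have le2 := pairing_le2 v_off PB.
  have [i defB] := pairing_block PB; have iB : i \in B by rewrite defB inE /paired eqxx.
  have [_] := andP (v_good i); rewrite negb_forall => /existsP[j].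
  rewrite negb_imply negbK => /andP[nji ijv]; exists i, j; rewrite eq_sym; split=> //.
  apply/esym/eqP; rewrite eqEcard cards2 eq_sym nji le2 andbT.
  by apply/subsetP => x; rewrite !inE => /orP[] /eqP-> //; rewrite defB inE /paired ijv orbT.
have cardP : #|pairing v| = #|I|./2.
  rewrite -cardsT (card_uniform_partition _ partP (n := 2)) ?muln2 ?doubleK //.
  by move=> B /P2[i [j [nij -> _]]]; rewrite cards2 nij.
exists (fun a => enum_val (cast_ord (esym cardP) a)); split=> [a | a b nab].
  by have [i [j [_ ? ?]]] := P2 _ (enum_valP (cast_ord (esym cardP) a)); exists i, j.
have /and3P[_ /trivIsetP tI _] := partP.
apply: tI; rewrite ?enum_valP //.
by rewrite (inj_eq enum_val_inj) (inj_eq (@cast_ord_inj _ _ _)).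
Qed.

(* When #|I| is even, a vector off the points g i lies on an even number of
   tangents, hence on at least two when it lies on one; this is what makes a
   bound on the number of tangents sufficient. *)
Lemma card_on_no_tangent : ~~ odd #|I| ->
  (2 * q ^ 3 <= 2 * #|[set v | on_no_tangent v]| + 2 * (#|I| * q)
                + \sum_i #|[set v | on_tangent i v]|)%N.
Proof.
move=> evenI.
have -> : (2 * q ^ 3 = \sum_(v : 'cV[F]_3) 2)%N.
  by rewrite sum_nat_const card_mx muln1 mulnC.
have -> : (#|I| * q = \sum_i #|[set v | v \in <[g i]>%VS]|)%N.
  rewrite -sum_nat_const; apply: eq_bigr => i _; rewrite cardsE.
  by rewrite card_vspace dim_point expn1.
under [X in (_ <= _ + X)%N]eq_bigr => i _ do rewrite -sum_indicator.
under [X in (_ <= _ + 2 * X + _)%N]eq_bigr => i _ do rewrite -sum_indicator.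
rewrite -sum_indicator [X in (_ <= _ + 2 * X + _)%N]exchange_big.
rewrite [X in (_ <= _ + X)%N]exchange_big !big_distrr -!big_split /=.
(* Each [v] gets weight at least 2 on the right: from being on no tangent, from lying in some
   [<[g i]>], or from two tangents. *)
apply: leq_sum => v _; have [// | v_bad] := boolP (on_no_tangent v).
have [/existsP[i iv] | ] := boolP [exists i, v \in <[g i]>%VS].
  by rewrite (bigD1 i) //= iv; lia.
rewrite negb_exists => /forallP v_off.
move: v_bad; rewrite negb_forall => /existsP[i].
rewrite v_off /= negbK => iv; have [j nji jv] := ex_other_tangent v_off evenI iv.
by apply: leq_trans (leq_addl _ _); rewrite (bigD1 i) // (bigD1 j) //= iv jv.
Qed.

Lemma span_on_no_tangent : (4 <= q)%N -> #|I| = m2 q ->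
  <<enum [set v | on_no_tangent v]>>%VS = fullv.
Proof.
move=> q4 cardI.
have evenI : ~~ odd #|I| by rewrite cardI /m2; case: ifP => /= ->.
apply/eqP; rewrite eqEdim subvf /= leqNgt; apply/negP => dim_lt.
(* A proper subspace has dimension at most 2, hence at most [q ^ 2] vectors. *)
have : (#|[set v | on_no_tangent v]| <= q ^ 2)%N.
  apply: (@leq_trans #|<<enum [set v | on_no_tangent v]>>%VS|).
    by apply/subset_leq_card/subsetP => v sv; rewrite memv_span ?mem_enum.
  rewrite card_vspace leq_pexp2l; [by [] | lia |].
  by move: dim_lt; rewrite dimvf /dim /= muln1.
have := card_on_no_tangent evenI.
have : (\sum_i #|[set v | on_tangent i v]| + #|I| * (#|I|.-1 * (q ^ 2 - q) + q)
        <= #|I| * q ^ 3)%N.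
  rewrite -!sum_nat_const -big_split /=; apply: leq_sum => i _.
  by rewrite addnA card_on_tangent.
move: (\sum_i _)%N (#|[set v | _]|) => t s; rewrite cardI /m2.
move: q q4 => x; case: ifP => ox x4 /=.
  (* With [q + 1] points the bounds conflict when [q ^ 2 > 4 * q + 1], which holds from 5 on but
     fails at 4; oddness excludes 4. *)
  have x5 : (5 <= x)%N by case: x ox x4 => [|[|[|[|[]]]]].
  by nia.
by nia.
Qed.

End Arc.

(** * Independent families and invertible matrices *)

Lemma span_ex_free (K : fieldType) (vT : vectType K) (S : seq vT) (k : nat) :
  (k <= \dim <<S>>)%N -> exists X, [/\ size X = k, free X & {subset X <= S}].
Proof.
elim: k => [|k IHk] kS; first by exists [::]; rewrite nil_free.
have [X [sizeX freeX XS]] := IHk (ltnW kS).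
have /allPn[x Sx Xx] : ~~ all [in <<X>>%VS] S.
  apply: contraL kS => /allP/span_subvP/dimvS SX.
  by rewrite -leqNgt (leq_trans SX) // -sizeX dim_span.
exists (x :: X); rewrite /= sizeX free_cons Xx; split=> // y.
by rewrite inE => /predU1P[-> | /XS].
Qed.

Lemma unitmx_free_col (K : fieldType) (k : nat) (A : 'M[K]_k)
    (X : k.-tuple 'cV[K]_k) :
  (forall s, col s A = X`_s) -> (A \in unitmx) = free X.
Proof.
move=> colA; have sumX (c : 'I_k -> K) : \sum_s c s *: X`_s = A *m \col_s c s.
  rewrite -[A in RHS]trmxK -[RHS]trmxK trmx_mul trmxK mulmx_sum_row linear_sum.
  apply: eq_bigr => s _; rewrite !mxE linearZ /= -colA.
  by congr (_ *: _); apply/colP => r; rewrite !mxE.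
apply/idP/freeP => [uA c | X_free].
  rewrite sumX => /(congr1 (mulmx (invmx A))); rewrite mulmx0 mulKmx // => c0 s.
  by have /colP/(_ s) := c0; rewrite !mxE.
(* [det0P] yields a row vector in the left kernel, so the transpose is used to get a dependency
   among columns. *)
rewrite -unitmx_tr unitmxE unitfE; apply/det0P => -[v /eqP v0 vA0]; case: v0.
apply/rowP => s; rewrite mxE; apply: X_free s; rewrite sumX.
apply: trmx_inj; rewrite trmx_mul trmx0 -[RHS]vA0; congr (_ *m _).
by apply/rowP => s; rewrite !mxE.
Qed.

(** * Generator matrices, recovery sets and MDS codes *)

Section Code.
Variables (F : finFieldType) (n k : nat) (C : {vspace 'rV[F]_n}).

Lemma ex_generator_matrix : \dim C = k ->
  exists G : 'M[F]_(k, n), [/\ forall u : 'rV_k, u *m G \in C,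
    forall u : 'rV_k, u *m G = 0 -> u = 0 & forall c, c \in C -> exists u : 'rV_k, c = u *m G].
Proof.
move=> <-; exists (\matrix_i (vbasis C)`_i).
have mulE (u : 'rV_(\dim C)) : u *m (\matrix_i (vbasis C)`_i) = \sum_i u 0 i *: (vbasis C)`_i.
  by rewrite mulmx_sum_row; apply: eq_bigr => i _; rewrite rowK.
split=> [u | u | c cC].
- by rewrite mulE memv_suml // => i _; rewrite memvZ // vbasis_mem ?mem_nth ?size_tuple.
- rewrite mulE => u0; apply/rowP => i; rewrite mxE.
  by have /freeP := basis_free (vbasisP C); apply.
- exists (\row_i coord (vbasis C) i c); rewrite mulE {1}(coord_vbasis cC).
  by apply: eq_bigr => i _; rewrite mxE.
Qed.

Lemma generator_matrix_spanning (G : 'M[F]_(k, n)) : \dim C = k ->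
  (forall c, c \in C -> exists u : 'rV_k, c = u *m G) -> generator_matrix C G.
Proof.
move=> dimC spanG; rewrite /generator_matrix basisEdim.
rewrite size_map size_enum_ord dimC leqnn andbT.
apply/subvP => c /spanG[u ->]; rewrite mulmx_sum_row memv_suml // => i _.
by rewrite memvZ // memv_span // (map_f (fun i => row i G)) ?mem_enum.
Qed.

(** Multiplication by [invmx M] sends column [i] of [M] to the unit vector and the columns of [G] to
    those of the new matrix. *)
Lemma recovery_set_mulmx (G : 'M[F]_(k, n)) (M : 'M[F]_k) (i : 'I_k) (j l : 'I_n) :
  M \in unitmx -> col i M \in <<[:: col j G; col l G]>>%VS ->
  recovery_set (invmx M *m G) i [set j; l].
Proof.
move=> uM; rewrite span_cons span_seq1 => /memv_addP[_ /vlineP[a ->]].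
case=> _ /vlineP[b ->] /(congr1 (mulmx (invmx M))).
have colM (x : 'I_n) : invmx M *m col x G = col x (invmx M *m G).
  by rewrite !colE mulmxA.
rewrite colE mulKmx // mulmxDr -!scalemxAr !colM /recovery_set => ->.
by rewrite memvD // memvZ // memv_span // (map_f (fun x => col x _)) //
  mem_enum !inE eqxx ?orbT.
Qed.

End Code.

(* A dependency among three columns of G yields a nonzero message u whose
   codeword u *m G vanishes at three positions. *)
Lemma mds_arc (F : finFieldType) (n : nat) (C : {vspace 'rV[F]_n}) (G : 'M[F]_(3, n)) :
  (3 <= n)%N -> has_min_dist C (n - 2) -> (forall u : 'rV_3, u *m G \in C) ->
  (forall u : 'rV_3, u *m G = 0 -> u = 0) -> arc (fun j => col j G).
Proof.
move=> n3 [_ minC] GC G_inj i j l ijl.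
pose t := [tuple i; j; l]; pose A := colsub (tnth t) G.
rewrite -(@unitmx_free_col _ _ A [tuple col i G; col j G; col l G]); last first.
  move=> s; rewrite -(tnth_nth _ [tuple col i G; col j G; col l G]).
  rewrite (_ : [tuple _; _; _] = map_tuple (fun x => col x G) t); last exact: val_inj.
  by rewrite tnth_map; apply/colP => r; rewrite !mxE.
rewrite unitmxE unitfE; apply/det0P => -[u u0 uA].
have /minC/(_ (mem0v C)) := GC u.
have uG0 : u *m G != 0 by apply: contraNneq u0 => /G_inj->.
move=> /(_ uG0); apply/negP; rewrite -ltnNge /hamming_dist.
have /card_uniqP cardt : uniq t by [].
(* The codeword can be nonzero only outside three distinct positions, so its weight is at most
   [n - 3]. *)
apply: (@leq_ltn_trans #|~: [set x in t]|); last first.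
  by have := cardsC [set x in t]; rewrite cardsE cardt card_ord /=; lia.
apply/subset_leq_card/subsetP => x; rewrite in_set mxE in_setC; apply: contraNN.
rewrite in_set => /tnthP[s ->]; have /rowP/(_ s) := uA; rewrite !mxE => us.
apply/eqP; rewrite -[RHS]us.
by apply: eq_bigr => r _; rewrite !mxE.
Qed.

Theorem corollary17 (F : finFieldType) (q n : nat) (C : {vspace 'rV[F]_n})
    (hF : #|F| = q) (hq : (4 <= q)%N) (hn : n = m2 q)
    (hC : is_mds_code 3 (n - 2) C) :
  is_pir_code 3 (n./2) C.
Proof.
case: hC => -[dimC minC] _; rewrite -hF in hq hn.
have n3 : (3 <= n)%N by rewrite hn /m2; case: ifP; lia.
have [G [GC G_inj G_onto]] := ex_generator_matrix dimC.
have arcG := mds_arc n3 minC GC G_inj.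
have I3 : (3 <= #|'I_n|)%N by rewrite card_ord.
have := span_on_no_tangent arcG I3 hq; rewrite card_ord => /(_ hn) spanS.
have [|X [sizeX freeX XS]] := @span_ex_free _ _
    (enum [set v | on_no_tangent (fun j => col j G) v]) 3.
  by rewrite spanS dimvf.
(* The columns of [M] are three independent vectors on no tangent, which [invmx M] moves to the unit
   vectors. *)
pose M : 'M[F]_3 := \matrix_(r, s) (X`_s : 'cV[F]_3) r 0.
have colM s : col s M = X`_s by apply/colP => r; rewrite !mxE.
have uM : M \in unitmx.
  by rewrite (@unitmx_free_col _ _ M (Tuple (introT eqP sizeX))).
exists (invmx M *m G); split=> [|i].
  apply: generator_matrix_spanning => // c /G_onto[u ->]; exists (u *m M).
  by rewrite mulmxA mulmxK.
have Xi : X`_i \in [set v | on_no_tangent (fun j => col j G) v].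
  by rewrite -mem_enum XS // mem_nth ?sizeX.
rewrite inE in Xi.
have := on_no_tangent_disjoint_chords arcG I3 Xi.
rewrite card_ord => -[J [JX J_disj]]; exists J; split=> // a.
have [j [l [-> Xjl]]] := JX a.
by apply: recovery_set_mulmx; rewrite ?colM.
Qed.
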